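(* Let $k\in\mathbb N$, let $M_i=(J,\Sigma,\mu,\mathcal F_i)$, $i\in[k]$, be measurable matroids on the same standard measure space, with rank functions $r_i$, and let $r_\vee$ be the rank function of their measurable union $M_\vee=\bigvee_{i=1}^kM_i$. Then for every $A\in\Sigma$, $$r_\vee(A)=\min_{X\subseteq A}\Big\{\mu(A\setminus X)+\sum_{i=1}^k r_i(X)\Big\},$$ where the minimum is over measurable sets $X\subseteq A$ (and is attained).
   Context: A standard measure space $(J,\Sigma,\mu)$ is a standard Borel space $(J,\Sigma)$ with a finite atomless measure $\mu\colon\Sigma\to[0,\infty)$. Convention: measurable sets are identified when they differ by a $\mu$-null set: $A=B$ means $\mu(A\triangle B)=0$, $A\subseteq B$ means $\mu(A\setminus B)=0$, and families of measurable sets are families in the measure algebra (membership is unaffected by null modifications). A set $X$ in a family $\mathcal X$ is maximal in $\mathcal X$ if $X\subseteq Y\in\mathcal X$ implies $Y\subseteq X$. Write $\mathcal X|Z=\{X\in\mathcal X\mid X\subseteq Z\}$ and $[k]=\{1,\dots,k\}$. A measurable matroid $M=(J,\Sigma,\mu,\mathcal F)$ consists of a standard measure space and a family $\mathcal F\subseteq\Sigma$ (the independent sets) satisfying: (I1) $\emptyset\in\mathcal F$; (I2) $F_1\subseteq F_2\in\mathcal F$ implies $F_1\in\mathcal F$; (I3) for all $X\in\Sigma$ and all maximal $F_1,F_2\in\mathcal F|X$, $\mu(F_1)=\mu(F_2)$; (I4) if $(F_i)_{i\in\mathbb N}$ is an increasing sequence in $\mathcal F$, then $\bigcup_i F_i\in\mathcal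 F$. Its rank function is $r(X)=\mu(F)$ for any maximal $F\in\mathcal F|X$ (such $F$ exists and the value does not depend on the choice). For families $\mathcal S_1,\dots,\mathcal S_k\subseteq\Sigma$, $\mathcal S_1+\dots+\mathcal S_k=\{S_1\cup\dots\cup S_k\mid S_i\in\mathcal S_i\}$. The upward closure of $\mathcal X\subseteq\Sigma$ is $\overline{\mathcal X}=\{\bigcup_{i=1}^\infty X_i\mid (X_i)_{i\in\mathbb N}\text{ increasing in }\mathcal X\}$. The measurable union $\bigvee_{i=1}^kM_i=M_1\vee\dots\vee M_k$ is $(J,\Sigma,\mu,\overline{\mathcal F_1+\dots+\mathcal F_k})$, which is a measurable matroid. *)

(* Defs.v *)
From HB Require Import structures.
From mathcomp Require Import all_boot all_order all_algebra.
From mathcomp Require Import all_classical all_reals all_analysis.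

Set Implicit Arguments.
Unset Strict Implicit.
Unset Printing Implicit Defensive.

Import Order.TTheory GRing.Theory Num.Theory.

Local Open Scope classical_set_scope.
Local Open Scope ring_scope.
Local Open Scope ereal_scope.

(** Completeness is spelled out because the library has no structure joining
    [metricType] and [completeType]. *)
Definition polish (R : realType) (X : metricType R) : Prop :=
  (exists2 D : set X, countable D & dense D) /\
  (forall G : set_system X, ProperFilter G -> cauchy G -> exists l : X, G --> l).

(** The sigma-algebra of [T] is, up to a bijection, the Borel sigma-algebra of
    a Polish space. *)
Definition standard_borel (R : realType) (d : measure_display)
    (T : measurableType d) : Prop :=
  exists X : metricType R, polish X /\
    exists2 f : T -> X, bijective f &
      forall B : set X, measurable (f @^-1` B) <-> <<s [set U : set X | open U] >> B.

Section MeasureAlgebra.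
Context (R : realType) (d : measure_display) (T : measurableType d).
Variable mu : {finite_measure set T -> \bar R}.
Implicit Types (X Y : set T) (S : set (set T)).

Definition atomless : Prop :=
  forall X, measurable X -> 0 < mu X ->
    exists Y, [/\ measurable Y, Y `<=` X, 0 < mu Y & mu Y < mu X].

(** Inclusion and equality in the measure algebra. The relations and families
    below are all taken modulo null sets through these two. *)
Definition ae_sub X Y : Prop := mu (X `\` Y) = 0.

Definition ae_same X Y : Prop := mu ((X `\` Y) `|` (Y `\` X)) = 0.

Definition restrict S Z : set (set T) := [set X | S X /\ ae_sub X Z].

Definition maximal_in S X : Prop :=
  S X /\ forall Y, S Y -> ae_sub X Y -> ae_sub Y X.

Definition ae_increasing (X : nat -> set T) : Prop :=
  {homo X : i j / (i <= j)%N >-> ae_sub i j}.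

(** Invariance of [F] under null modifications is a consequence of (I2), in
    which the inclusion is modulo null sets. *)
Record measurable_matroid (F : set (set T)) : Prop := MeasurableMatroid {
  indep_measurable : F `<=` measurable ;
  indep0 : F set0 ;
  indep_sub : forall F1 F2, measurable F1 -> ae_sub F1 F2 -> F F2 -> F F1 ;
  indep_maximal : forall X F1 F2, measurable X ->
    maximal_in (restrict F X) F1 -> maximal_in (restrict F X) F2 ->
    mu F1 = mu F2 ;
  indep_bigcup : forall Fs : nat -> set T, (forall i, F (Fs i)) ->
    ae_increasing Fs -> F (\bigcup_i Fs i) }.

(** The measure of some maximal member of [restrict F X]. For a measurable
    matroid a maximal member exists and its measure does not depend on the
    choice; the default [set0] is then never used. *)
Definition rank (F : set (set T)) X : \bar R :=
  mu (xget set0 [set Y | maximal_in (restrict F X) Y]).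

Lemma rankE (F : set (set T)) X Y : measurable_matroid F -> measurable X ->
  maximal_in (restrict F X) Y -> rank F X = mu Y.
Proof.
move=> MF mX maxY; apply: (indep_maximal MF mX) => //.
by rewrite /rank; case: xgetP => [Z _ //|/(_ Y)].
Qed.

(** For [k = 0] the sum is the family of null sets. *)
Definition family_sum (k : nat) (S : 'I_k -> set (set T)) : set (set T) :=
  [set X | measurable X /\ exists2 G : 'I_k -> set T,
    (forall i, S i (G i)) & ae_same X (\bigcup_i G i)].

Definition upward_closure S : set (set T) :=
  [set X | measurable X /\ exists2 Y : nat -> set T,
    (forall i, S (Y i)) /\ ae_increasing Y & ae_same X (\bigcup_i Y i)].

Definition measurable_union (k : nat) (F : 'I_k -> set (set T)) :
  set (set T) := upward_closure (family_sum F).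

End MeasureAlgebra.

Definition is_minimum (R : realType) (x : \bar R) (A : set (\bar R)) : Prop :=
  A x /\ lbound A x.

(* Main.v *)
Require Import Defs.
From HB Require Import structures.
From mathcomp Require Import all_boot all_order all_algebra.
From mathcomp Require Import all_classical all_reals all_analysis.
From mathcomp Require Import ring lra.

(** Measures of packings, that is, of unions of pairwise disjoint sets [I_i]
    with [I_i] independent in the [i]-th matroid, are bounded by the dual value
    [mu (A \ X) + sum_i r_i(X)]: the part outside [X] is counted by the measure,
    and [I_i] has at most [r_i(X)] inside [X]. Members of the measurable union are
    limits of packable sets, so the same bound holds for them.

    For the converse one would like to take a largest packing in [A] and the set
    of points reachable by exchanges from the uncovered part. In a measurable
    matroid a largest packing need not exist, so the augmenting path argument is
    made quantitative. Starting from the uncovered part [S_0], layers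
    [S_0, S_1, ...] are built, where [S_(l+1)] adds to [S_l] a part of each [I_j]
    that nearly spans [S_l] in the [j]-th matroid ([exists_next_layer]). These
    parts are penalised minimisers rather than minimal spanning sets; this makes
    the room freed by an exchange proportional to the measure exchanged. Hence
    a set of measure [e] in [S_l] that can be added to some [I_i] lets the packing
    grow by at least [c ^ l * e], a bound that does not depend on the packing
    ([augment]). A packing close enough to the supremum thus has no such
    augmentation in its first [N] layers, and since [mu A] is finite one of these
    layers is almost equal to the next one. On that layer every [I_j] almost
    realises the rank, so it serves as a nearly optimal [X]
    ([near_optimal_packing]).

    Two limit arguments turn this into the exact formula. The dual value is
    submodular and Lipschitz in [X], so its infimum is attained
    ([exists_submodular_argmin]). And a member [Y] of the union inside [A] whose
    measure is below the minimum is not maximal: approximate duality gives an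
    exchange property for packings ([packing_exchange]), which is iterated along
    packings filling [Y], with summable losses ([union_extend]). *)

Set Implicit Arguments.
Unset Strict Implicit.
Unset Printing Implicit Defensive.

Import Order.TTheory GRing.Theory Num.Theory.

Local Open Scope classical_set_scope.
Local Open Scope ring_scope.

(** * Near-optimal elements and iterated choice *)

Ltac set_tac :=
  rewrite /setU /setI /setD /setC /mkset /subset /=; intros; tauto.
Ltac set_eq := apply/seteqP; split; set_tac.

Lemma near_max (R : realType) (T : Type) (P : set T) (f : T -> R) (M e : R) :
    P !=set0 -> (forall t, P t -> f t <= M) -> 0 < e ->
  exists2 t, P t & forall u, P u -> f u <= f t + e.
Proof.
move=> [t0 Pt0] fM e0.
have ubf : has_ubound (f @` P) by exists M => _ [t Pt <-]; exact: fM.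
have sf : has_sup (f @` P) by split => //; exists (f t0), t0.
have [_ [t Pt <-] lt_t] := sup_adherent e0 sf.
exists t => // u Pu; rewrite -lerBlDr (le_trans _ (ltW lt_t))// lerD2r.
by apply: ub_le_sup => //; exists u.
Qed.

Lemma bigcup_ord0 (T : Type) (G : 'I_0 -> set T) : \bigcup_i G i = set0.
Proof. by rewrite -subset0 => x [[]]. Qed.

Lemma bigcup_ord_recl (T : Type) k (G : 'I_k.+1 -> set T) :
  \bigcup_i G i = G ord0 `|` \bigcup_i G (lift ord0 i).
Proof.
apply/seteqP; split => [x [i _ Gx]|x [Gx|[i _ Gx]]]; last 2 first.
- by exists ord0.
- by exists (lift ord0 i).
by case: (unliftP ord0 i) Gx => [j ->|->] Gx; [right; exists j|left].
Qed.

Lemma dependent_iteration (T : Type) (P : T -> Prop) (Q : nat -> T -> T -> Prop)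
    (t0 : T) : P t0 ->
    (forall n t, P t -> exists2 u, P u & Q n t u) ->
  exists f : nat -> T, [/\ f 0%N = t0, forall n, P (f n) &
    forall n, Q n (f n) (f n.+1)].
Proof.
move=> Pt0 step.
have /choice[g gP] : forall nt : nat * T, exists u : T,
    P nt.2 -> P u /\ Q nt.1 nt.2 u.
  move=> [n t] /=.
  by have [/(step n)[u]|] := pselect (P t); [exists u|exists t].
pose f := fix f n := if n is n'.+1 then g (n', f n') else t0.
have Pf n : P (f n) by elim: n => //= n /(gP (n, _))[].
by exists f; split => // n; have [] := gP (n, f n) (Pf n).
Qed.

(** * Finite measures with real values *)

(** All estimates below are linear inequalities between finite quantities, so
    measures and ranks are taken in [R]. *)
Definition measr (R : realType) d (T : measurableType d)
  (mu : {finite_measure set T -> \bar R}) (X : set T) : R := fine (mu X).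

Section RealMeasure.
Context (R : realType) (d : measure_display) (T : measurableType d).
Variable mu : {finite_measure set T -> \bar R}.
Local Notation m := (measr mu).
Implicit Types X Y Z : set T.

Lemma measrE X : measurable X -> mu X = (m X)%:E.
Proof. by move=> mX; rewrite /measr fineK// fin_num_measure. Qed.

Lemma measr_ge0 X : 0 <= m X.
Proof. exact: fine_ge0. Qed.

Lemma measr0 : m set0 = 0.
Proof. by rewrite /measr measure0. Qed.

Lemma measrID X Y : measurable X -> measurable Y ->
  m X = m (X `&` Y) + m (X `\` Y).
Proof.
move=> mX mY; apply: EFin_inj; rewrite EFinD -!measrE//.
- by rewrite addeC -measureDI.
- exact: measurableD.
- exact: measurableI.
Qed.

Lemma le_measr X Y : measurable X -> measurable Y -> X `<=` Y -> m X <= m Y.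
Proof.
by move=> mX mY XY; rewrite -lee_fin -!measrE// le_measure// inE.
Qed.

Lemma measrDsub X Y : measurable X -> measurable Y -> X `<=` Y ->
  m (Y `\` X) = m Y - m X.
Proof.
by move=> mX mY XY; rewrite (measrID mY mX) setIidr// addrC addKr.
Qed.

Lemma measrUI X Y : measurable X -> measurable Y ->
  m (X `|` Y) + m (X `&` Y) = m X + m Y.
Proof.
move=> mX mY; rewrite (measrID (measurableU _ _ mX mY) mY) (measrID mX mY).
rewrite (_ : (X `|` Y) `&` Y = Y); last by set_eq.
rewrite (_ : (X `|` Y) `\` Y = X `\` Y); last by set_eq.
by lra.
Qed.

Lemma measrU_le X Y : measurable X -> measurable Y -> m (X `|` Y) <= m X + m Y.
Proof. by move=> mX mY; rewrite -measrUI// lerDl measr_ge0. Qed.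

Lemma ae_subE X Y : measurable X -> measurable Y ->
  ae_sub mu X Y <-> m (X `\` Y) = 0.
Proof.
move=> mX mY; have mXY : measurable (X `\` Y) by exact: measurableD.
rewrite /ae_sub (measrE mXY); split => [|->//]; exact: EFin_inj.
Qed.

Lemma ae_sub_subset X Y : X `<=` Y -> ae_sub mu X Y.
Proof. by move=> XY; rewrite /ae_sub (_ : X `\` Y = set0) ?measure0// setD_eq0. Qed.

Lemma ae_sub_measr X Y : measurable X -> measurable Y -> ae_sub mu X Y ->
  m X <= m Y.
Proof.
move=> mX mY /(ae_subE mX mY) XY; rewrite (measrID mX mY) XY addr0.
by apply: le_measr => //; exact: measurableI.
Qed.

Lemma ae_sub_trans Y X Z : measurable X -> measurable Y -> measurable Z ->
  ae_sub mu X Y -> ae_sub mu Y Z -> ae_sub mu X Z.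
Proof.
move=> mX mY mZ /(ae_subE mX mY) XY /(ae_subE mY mZ) YZ; apply/ae_subE => //.
apply/eqP; rewrite eq_le measr_ge0 andbT -[leRHS](addr0 0).
rewrite -{1}XY -YZ.
apply: le_trans (measrU_le (measurableD mX mY) (measurableD mY mZ)).
apply: le_measr; first exact: measurableD.
- by apply: measurableU; exact: measurableD.
- by move=> x; have := pselect (Y x); set_tac.
Qed.

Lemma measr_bigcup_le k (G : 'I_k -> set T) : (forall i, measurable (G i)) ->
  m (\bigcup_i G i) <= \sum_i m (G i).
Proof.
elim: k G => [|k IH] G mG; first by rewrite big_ord0 bigcup_ord0 measr0.
rewrite big_ord_recl bigcup_ord_recl.
apply: le_trans (measrU_le _ _) _ => //.
  by apply: fin_bigcup_measurable => // i _; exact: mG.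
by rewrite lerD2l; exact: (IH (fun i => G (lift ord0 i))).
Qed.

Lemma measr_bigcup k (G : 'I_k -> set T) : (forall i, measurable (G i)) ->
  trivIset setT G -> m (\bigcup_i G i) = \sum_i m (G i).
Proof.
elim: k G => [|k IH] G mG tG; first by rewrite big_ord0 bigcup_ord0 measr0.
rewrite big_ord_recl bigcup_ord_recl -(IH (fun i => G (lift ord0 i)))//.
  rewrite -measrUI//; last by apply: fin_bigcup_measurable => // i _; exact: mG.
  rewrite (_ : _ `&` _ = set0) ?measr0 ?addr0// -subset0 => x [G0 [i _ Gi]].
  by have := tG _ _ I I (ex_intro _ x (conj G0 Gi)).
by move=> i j _ _ /(tG _ _ I I); exact: lift_inj.
Qed.

Lemma measr_decr_cvg0 (E : nat -> set T) (e : R) :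
    (forall n, measurable (E n)) -> (forall n, E n.+1 `<=` E n) ->
    \bigcap_n E n = set0 -> 0 < e -> exists n, m (E n) <= e.
Proof.
move=> mE dE E0 e0.
have : (mu \o E) @ \oo --> mu (\bigcap_n E n).
  apply: nonincreasing_cvg_mu => //.
  - by rewrite -ge0_fin_numE// fin_num_measure.
  - by rewrite E0.
  - by apply/nonincreasing_seqP => n; apply/subsetPset; exact: dE.
rewrite E0 measure0 => /fine_cvgP[_] /cvgr0Pnorm_le /(_ e e0)[n _ /(_ n)] /=.
by move=> /(_ (leqnn n)) /(le_trans (ler_norm _)) ?; exists n.
Qed.

Lemma measr_bigcup_summable (E : nat -> set T) (X : set T) (e : R) :
    (forall n, measurable (E n)) -> measurable X -> X `<=` \bigcup_n E n ->
    (forall n, m (E n) <= e / (2 ^ n.+1)%:R) -> m X <= e.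
Proof.
move=> mE mX XE Ee; rewrite -lee_fin -measrE//.
apply: (le_trans (measure_sigma_subadditive mu mE mX XE)).
have e0 : 0 <= e.
  by have := le_trans (measr_ge0 _) (Ee 0%N); rewrite pmulr_lge0.
apply: le_trans (epsilon_trick0 xpredT e0).
apply: lee_nneseries => [n _ _|n _]; first exact: measure_ge0.
by have := Ee n; rewrite -lee_fin -(measrE (mE n)).
Qed.

(** The Borel-Cantelli lemma, with the summability given by a geometric
    bound. *)
Lemma lim_sup_null (E : nat -> set T) (X : set T) (e : R) :
    (forall n, measurable (E n)) -> measurable X -> X `<=` lim_sup_set E ->
    (forall n, m (E n) <= e / (2 ^ n.+1)%:R) -> m X = 0.
Proof.
move=> mE mX XE Ee.
have mL : measurable (lim_sup_set E).
  by apply: bigcap_measurable => // n _; exact: bigcup_measurable.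
apply/eqP; rewrite eq_le measr_ge0 andbT.
apply: (le_trans (le_measr mX mL XE)); rewrite /measr lim_sup_set_cvg0//.
have e0 : 0 <= e.
  by have := le_trans (measr_ge0 _) (Ee 0%N); rewrite pmulr_lge0.
apply: le_lt_trans (ltry e); apply: le_trans (epsilon_trick0 xpredT e0).
apply: lee_nneseries => [n _ _|n _]; first exact: measure_ge0.
by have := Ee n; rewrite -lee_fin -(measrE (mE n)).
Qed.

End RealMeasure.
(** * Maximal members of families closed under increasing unions *)

Section Maximal.
Context (R : realType) (d : measure_display) (T : measurableType d).
Variable mu : {finite_measure set T -> \bar R}.
Local Notation m := (measr mu).
Implicit Types X Y Z : set T.

Lemma ae_sub_bigcup (E : nat -> set T) X :
    (forall n, measurable (E n)) -> measurable X ->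
  (forall n, ae_sub mu (E n) X) -> ae_sub mu (\bigcup_n E n) X.
Proof.
move=> mE mX EX; have mU : measurable (\bigcup_n E n) by exact: bigcup_measurable.
apply/ae_subE => //; apply/eqP; rewrite eq_le measr_ge0 andbT.
apply: (@measr_bigcup_summable _ _ _ mu (fun n => E n `\` X)) => [n|||n].
- exact: measurableD.
- exact: measurableD.
- by rewrite setD_bigcupl.
- by rewrite mul0r (proj1 (ae_subE mu (mE n) mX) (EX n)).
Qed.

Lemma ae_increasing_step (E : nat -> set T) : (forall n, measurable (E n)) ->
  (forall n, ae_sub mu (E n) (E n.+1)) -> ae_increasing mu E.
Proof.
move=> mE incE i j /subnK <-; elim: (j - i)%N => [|n IH].
  exact: ae_sub_subset.
by rewrite addSn; apply: (ae_sub_trans (mE i) (mE (n + i)%N)).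
Qed.

(** Greedy exhaustion: the n-th set is enlarged to within 1/(n+1) of the largest
    measure reachable above it, so that the union of the sequence cannot be
    enlarged by a set of positive measure. *)
Lemma exists_maximal (S : set (set T)) Y : S `<=` measurable ->
    (forall E : nat -> set T, (forall n, S (E n)) -> ae_increasing mu E ->
      S (\bigcup_n E n)) ->
  S Y -> exists2 Z, maximal_in mu S Z & ae_sub mu Y Z.
Proof.
move=> mS clS SY.
pose near_top n Y Y' := ae_sub mu Y Y' /\
  forall W, S W -> ae_sub mu Y' W -> m W <= m Y' + n.+1%:R^-1.
have [n Z SZ|E [E0 SE topE]] := @dependent_iteration _ S near_top Y SY.
  have [|||W [SW ZW] topW] := @near_max R _ [set W | S W /\ ae_sub mu Z W] m
    (m setT) n.+1%:R^-1.
  - by exists Z; split => //; exact: ae_sub_subset.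
  - by move=> W [/mS mW _]; apply: le_measr.
  - by rewrite invr_gt0.
  exists W => //; split => // V SV WV; apply: topW; split => //.
  by apply: (ae_sub_trans _ _ _ ZW WV); exact: mS.
have mE n : measurable (E n) by exact/mS.
have [Z SZ EZ] : exists2 Z, S Z & forall n, E n `<=` Z.
  exists (\bigcup_n E n); last by move=> n; exact: bigcup_sup.
  by apply: clS => //; apply: ae_increasing_step => // n; case: (topE n).
rewrite -{}E0; exists Z; last exact: ae_sub_subset.
split=> // W SW ZW; have mW := mS _ SW; have mZ := mS _ SZ.
have WZ : m W <= m Z.
  rewrite leNgt; apply/negP => /ltr_add_invr[n ltW].
  have [_ /(_ W SW)] := topE n.
  have /[swap]/[apply] : ae_sub mu (E n.+1) W.
    by apply: (ae_sub_trans _ mZ) => //; exact: ae_sub_subset.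
  move=> leW; have leE := le_measr mu (mE n.+1) mZ (EZ n.+1).
  have := le_lt_trans (le_trans leW (lerD leE (lexx _))) ltW.
  by rewrite ltxx.
apply/ae_subE => //; move/(ae_subE mu mZ mW) : ZW => ZW.
have := measrID mu mW mZ; have := measrID mu mZ mW; rewrite setIC.
by have := measr_ge0 mu (W `\` Z); move=> *; lra.
Qed.

End Maximal.

(** * Rank functions of measurable matroids *)

Definition rankr (R : realType) d (T : measurableType d)
    (mu : {finite_measure set T -> \bar R}) (F : set (set T)) (X : set T) : R :=
  fine (rank mu F X).

Section Rank.
Context (R : realType) (d : measure_display) (T : measurableType d).
Variables (mu : {finite_measure set T -> \bar R}) (F : set (set T)).
Hypothesis MF : measurable_matroid mu F.
Local Notation m := (measr mu).
Local Notation r := (rankr mu F).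
Implicit Types X Y Z : set T.

Lemma indep_subset X Y : measurable X -> X `<=` Y -> F Y -> F X.
Proof. by move=> mX XY; apply: (indep_sub MF) => //; exact: ae_sub_subset. Qed.

Lemma exists_maximal_restrict I X : measurable X -> F I -> I `<=` X ->
  exists2 Z, maximal_in mu (Defs.restrict mu F X) Z & ae_sub mu I Z.
Proof.
move=> mX FI IX; have mF := indep_measurable MF; apply: exists_maximal.
- by move=> Z [/mF].
- move=> E SE incE; split; first by apply: (indep_bigcup MF) => // n; case: (SE n).
  by apply: ae_sub_bigcup => // n; case: (SE n) => // /mF.
- by split=> //; exact: ae_sub_subset.
Qed.

(** A maximal member is determined only up to null sets, and its inclusion in [X]
    holds only up to a null set; correcting it makes both inclusions literal. *)
Lemma exists_basis I X : measurable X -> F I -> I `<=` X ->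
  exists B, [/\ F B, I `<=` B, B `<=` X & m B = r X].
Proof.
move=> mX FI IX; have mF := indep_measurable MF.
have [Z maxZ IZ] := exists_maximal_restrict mX FI IX.
have [[FZ ZX] _] := maxZ; have mZ := mF _ FZ; have mI := mF _ FI.
have mB : measurable ((Z `|` I) `&` X) by apply: measurableI => //; exact: measurableU.
(* [Z] may differ by null sets from a set that contains [I] and lies in [X]. *)
have BZ : ae_sub mu ((Z `|` I) `&` X) Z.
  apply: (ae_sub_trans mB (measurableU _ _ mZ mI) mZ).
    by apply: ae_sub_subset; exact: subIsetl.
  move/(ae_subE mu mI mZ) : IZ => IZ; apply/ae_subE => //; first exact: measurableU.
  by rewrite setDUl setDv set0U.
exists ((Z `|` I) `&` X); split.
- exact: (indep_sub MF _ BZ).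
- by move=> x Ix; split; [right|exact: IX].
- exact: subIsetr.
rewrite /rankr (rankE MF mX maxZ); apply/eqP; rewrite eq_le.
apply/andP; split; first exact: ae_sub_measr.
apply: ae_sub_measr => //; move/(ae_subE mu mZ mX) : ZX => ZX; apply/ae_subE => //.
apply/eqP; rewrite eq_le measr_ge0 andbT -ZX.
by apply: le_measr; [exact: measurableD|exact: measurableD|set_tac].
Qed.

Lemma rankrE X : measurable X -> rank mu F X = (r X)%:E.
Proof.
move=> mX.
have [Z maxZ _] := exists_maximal_restrict mX (indep0 MF) (@sub0set _ X).
have [[/(indep_measurable MF) mZ _] _] := maxZ.
by rewrite /rankr (rankE MF mX maxZ) measrE.
Qed.

Lemma indep_le_rank I X : measurable X -> F I -> I `<=` X -> m I <= r X.
Proof.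
move=> mX FI IX; have [B [FB IB _ <-]] := exists_basis mX FI IX.
by apply: le_measr => //; exact: (indep_measurable MF).
Qed.

Lemma rank_le_measr X : measurable X -> r X <= m X.
Proof.
move=> mX; have [B [FB _ BX <-]] := exists_basis mX (indep0 MF) (@sub0set _ X).
by apply: le_measr => //; exact: (indep_measurable MF).
Qed.

Lemma le_rank X Y : measurable X -> measurable Y -> X `<=` Y -> r X <= r Y.
Proof.
move=> mX mY XY.
have [B [FB _ BX <-]] := exists_basis mX (indep0 MF) (@sub0set _ X).
by apply: indep_le_rank => //; exact: subset_trans XY.
Qed.

Lemma rank_ge0 X : measurable X -> 0 <= r X.
Proof.
by move=> mX; rewrite -(measr0 mu); apply: indep_le_rank => //; exact: indep0 MF.
Qed.

(** A basis [B] of the intersection is extended to a basis [C] of the union;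
    the traces of [C] on [X] and on [Y] are independent, and their measures add
    up to at least that of [C] plus that of [B]. *)
Lemma rank_submodular X Y : measurable X -> measurable Y ->
  r (X `|` Y) + r (X `&` Y) <= r X + r Y.
Proof.
move=> mX mY; have mI := measurableI _ _ mX mY; have mU := measurableU _ _ mX mY.
have [B [FB _ BI <-]] := exists_basis mI (indep0 MF) (@sub0set _ _).
have BU : B `<=` X `|` Y by move=> x /BI[Xx _]; left.
have [C [FC BC CU <-]] := exists_basis mU FB BU.
have mB := indep_measurable MF FB; have mC := indep_measurable MF FC.
have FCI Z : measurable Z -> F (C `&` Z).
  by move=> mZ; apply: indep_subset FC; [exact: measurableI|exact: subIsetl].
have := indep_le_rank mX (FCI _ mX) (@subIsetr _ _ _).
have := indep_le_rank mY (FCI _ mY) (@subIsetr _ _ _).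
have := measrUI mu (measurableI _ _ mC mX) (measurableI _ _ mC mY).
rewrite -setIUr (setIidl CU).
have : m B <= m ((C `&` X) `&` (C `&` Y)).
  apply: le_measr => //; first by apply: measurableI; exact: measurableI.
  by move=> x Bx; have := BI _ Bx; have := BC _ Bx; set_tac.
by move=> *; lra.
Qed.

Lemma rankU_le X Y : measurable X -> measurable Y -> r (X `|` Y) <= r X + m Y.
Proof.
move=> mX mY; have := rank_submodular mX mY; have := rank_le_measr mY.
by have := rank_ge0 (measurableI _ _ mX mY); move=> *; lra.
Qed.

End Rank.
Lemma exists_small_step (R : realType) (u : nat -> R) (M : R) (N : nat) :
    (0 < N)%N -> 0 <= u 0%N -> (forall n, u n <= M) ->
  exists2 n, (n < N)%N & u n.+1 - u n <= M / N%:R.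
Proof.
move=> N0 u0 uM; apply: contrapT => no_small.
have big n : (n < N)%N -> u n + M / N%:R < u n.+1.
  move=> nN; rewrite ltNge; apply/negP => small; apply: no_small.
  by exists n => //; rewrite lerBlDl.
have low n : (n < N)%N -> n.+1%:R * (M / N%:R) < u n.+1.
  elim: n => [|n IH] nN.
    by rewrite mul1r; apply: le_lt_trans (big _ nN); rewrite lerDr.
  apply: lt_trans (big _ nN).
  by rewrite -natr1 mulrDl mul1r ltrD2r; exact/IH/ltnW.
case: N N0 low {big no_small} => // N _ /(_ N (ltnSn N)).
by rewrite mulrCA mulfV ?pnatr_eq0// mulr1 => /lt_le_trans/(_ (uM _)); rewrite ltxx.
Qed.

(** * Packings and augmentation *)

Section Packing.
Context (R : realType) (d : measure_display) (T : measurableType d).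
Variables (mu : {finite_measure set T -> \bar R}) (k : nat).
Variable F : 'I_k -> set (set T).
Hypothesis MF : forall i, measurable_matroid mu (F i).
Local Notation m := (measr mu).
Local Notation r i := (rankr mu (F i)).
Implicit Types (X Y Z A : set T) (I : 'I_k -> set T).

Definition packing I := (forall i, F i (I i)) /\ trivIset setT I.

Lemma packing_measurable I i : packing I -> measurable (I i).
Proof. by move=> [FI _]; exact: (indep_measurable (MF i)). Qed.

Lemma packing_bigcup_measurable I : packing I -> measurable (\bigcup_i I i).
Proof.
by move=> pI; apply: fin_bigcup_measurable => // i _; exact: packing_measurable.
Qed.

Lemma packing_disjoint I i j x : packing I -> I i x -> I j x -> i = j.
Proof. by move=> [_ tI] Ii Ij; apply: tI => //; exists x. Qed.

(** The same operation serves to move a part of some [I j] to [I i] and to give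
    uncovered points to [I i]: [X] need not lie in the union. *)
Definition transfer I i X j := if j == i then I j `|` X else I j `\` X.

Lemma transfer_packing I i X : packing I -> measurable X -> F i (I i `|` X) ->
  packing (transfer I i X).
Proof.
move=> pI mX FX; split=> [j|a b _ _ [x []]]; rewrite /transfer.
  case: eqP => [->//|_]; apply: (indep_subset (MF j) _ _ (pI.1 j)) => //.
  by apply: measurableD => //; exact: packing_measurable.
case: (eqVneq a i) => [->|ai]; case: (eqVneq b i) => [->//|bi].
- by move=> [Ia|Xx] [Ib] => // _; exact: packing_disjoint Ia Ib.
- by move=> [Ia _] [Ib|//]; exact: packing_disjoint Ia Ib.
- by move=> [Ia _] [Ib _]; exact: packing_disjoint Ia Ib.
Qed.

Lemma bigcup_transfer I i X : \bigcup_j transfer I i X j = \bigcup_j I j `|` X.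
Proof.
apply/seteqP; split => x.
  move=> [j _]; rewrite /transfer; case: eqP => [_ [Ij|]|_ [Ij _]].
  - by left; exists j.
  - by right.
  - by left; exists j.
have [Xx _|nXx [[j _ Ij]|//]] := pselect (X x).
  by exists i => //; rewrite /transfer eqxx; right.
by exists j => //; rewrite /transfer; case: eqP => _; [left|split].
Qed.

Lemma pigeonhole I X : (forall i, measurable (I i)) -> measurable X ->
    X `<=` \bigcup_i I i -> 0 < m X ->
  exists i, m X <= k.+1%:R * m (X `&` I i).
Proof.
move=> mI mX XI X0; apply: contrapT => small.
have lt_i i : m (X `&` I i) <= m X / k.+1%:R.
  rewrite leNgt; apply/negP => big; apply: small; exists i.
  by rewrite mulrC -ler_pdivrMr// ltW.
have : m X <= \sum_i m (X `&` I i).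
  apply: le_trans (measr_bigcup_le mu _) => [|i]; last exact: measurableI.
  rewrite -setI_bigcupr; apply: le_measr => //; last first.
    by move=> x Xx; split=> //; exact: XI.
  by apply: measurableI => //; exact: fin_bigcup_measurable.
move=> /le_trans/(_ (ler_sum _ (fun i _ => lt_i i))).
rewrite sumr_const card_ord -(mulr_natr _ k) -mulrA ler_pMr//.
by rewrite ler_pdivlMl// mulr1 ler_nat ltnn.
Qed.

(** A quantitative substitute for: [I j `&` Y] is a minimal subset of [I j] that
    spans [X] in the [j]-th matroid. Removing [D] from it lowers the rank of
    its union with [X] by at most [(1 - lam) * m D], up to [eta], while the set
    itself loses [m D]; so about [lam * m D] worth of [X] becomes addable. The
    inequality depends on [I] only through the traces [I j `&` Y], hence
    survives any transfer of a set that is disjoint from [Y]. *)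
Definition exchangeable (lam eta : R) I X Y := forall j D, measurable D ->
  D `<=` (I j `&` Y) `\` X ->
  r j (X `|` (I j `&` Y)) <= r j (X `|` ((I j `&` Y) `\` D)) + (1 - lam) * m D + eta.

(** An augmenting path of length [l], run from its far end. A set of measure [e]
    in layer [l] can be added to [I i]. If half of it already lies in layer
    [l - 1], shorten the path. Otherwise a part [D0] of measure at least e/(2(k+1))
    lies in a single [I j], by the pigeonhole principle; transferring [D0] from
    [I j] to [I i] keeps the union and frees room in [I j] for a set of measure
    [c * e] from layer [l - 1]. As [D0] avoids layer [l - 1], the exchange
    property of the lower layers is untouched, and the induction goes on with
    the new packing. The gain [c ^+ l * e] does not depend on the packing, which
    is what makes a near-optimal packing impossible to augment. *)
Lemma augment (lam eta c : R) (S : nat -> set T) I l i (e : R) :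
    0 < c -> c * (4 * k.+1%:R) = lam -> lam <= 1 ->
    (forall n, measurable (S n)) -> {homo S : a b / (a <= b)%N >-> a `<=` b} ->
    packing I -> S 0%N `&` \bigcup_j I j = set0 ->
    (forall n, (n < l)%N -> S n.+1 `<=` S n `|` \bigcup_j I j) ->
    (forall n, (n < l)%N -> exchangeable lam eta I (S n) (S n.+1)) ->
    0 < e -> eta <= c ^+ l * e -> m (I i) + e <= r i (I i `|` S l) ->
  exists I', [/\ packing I', \bigcup_j I j `<=` \bigcup_j I' j,
    \bigcup_j I' j `<=` S 0%N `|` \bigcup_j I j &
    m (\bigcup_j I j) + c ^+ l * e <= m (\bigcup_j I' j)].
Proof.
move=> c0 clam lam1 mS incS.
have K1 : (1 : R) <= k.+1%:R by rewrite ler1n.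
have c4 : c <= 4^-1 by rewrite -clam in lam1; nra.
elim: l I i e => [|l IH] I i e pI disj sub exch e0 eta_le aug.
  have mI := packing_measurable i pI.
  have [B [FB IB BX mB]] := exists_basis (MF i) (measurableU _ _ mI (mS 0%N))
    (pI.1 i) (@subsetUl _ _ _).
  have mBB := indep_measurable (MF i) FB; have mD := measurableD mBB mI.
  have UD : I i `|` (B `\` I i) = B by exact: setDUK.
  exists (transfer I i (B `\` I i)); rewrite bigcup_transfer; split.
  - by apply: transfer_packing => //; rewrite UD.
  - exact: subsetUl.
  - by move=> x [?|[/BX[]]]; [right| |left].
  - have mU := packing_bigcup_measurable pI.
    have := measrUI mu mU mD; rewrite (_ : _ `&` _ = set0) ?measr0; last first.
      rewrite -subset0 -disj => x [Ux [Bx nIx]]; split=> //.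
      by case: (BX _ Bx).
    by rewrite (measrDsub mu mI mBB IB) expr0 mul1r; move=> *; lra.
have mI j := packing_measurable j pI.
have [B [FB IB BX mB]] := exists_basis (MF i) (measurableU _ _ (mI i) (mS l.+1))
  (pI.1 i) (@subsetUl _ _ _).
have mBB := indep_measurable (MF i) FB.
pose D := B `\` I i; have mD : measurable D := measurableD mBB (mI i).
have eD : e <= m D by rewrite /D (measrDsub mu (mI i) mBB IB) mB; lra.
have cl0 : 0 < c ^+ l by exact: exprn_gt0.
have cle : c ^+ l.+1 * e <= c ^+ l * (e / 2).
  have : c * (c ^+ l * e) <= 4^-1 * (c ^+ l * e) by rewrite ler_pM2r// mulr_gt0.
  by rewrite exprS; move: (c ^+ l) cl0 => p p0 h; have := mulr_gt0 p0 e0; lra.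
have [e2D|De2] := leP (e / 2) (m (D `&` S l)).
  have mD1 := measurableI _ _ mD (mS l).
  have [|||||I' [pI' II' I'S gain]] := IH I i (e / 2) pI disj.
  - by move=> n nl; apply: sub; exact: ltnW.
  - by move=> n nl; apply: exch; exact: ltnW.
  - by lra.
  - exact: le_trans cle.
  - have F1 : F i (I i `|` (D `&` S l)).
      apply: (indep_subset (MF i) _ _ FB); first exact: measurableU.
      by move=> x [/IB//|[[Bx _] _]].
    have sub1 : I i `|` (D `&` S l) `<=` I i `|` S l 
      by apply: setUS; exact: subIsetr.
    have := indep_le_rank (MF i) (measurableU _ _ (mI i) (mS l)) F1 sub1.
    have := measrUI mu (mI i) mD1; rewrite (_ : I i `&` _ = set0) ?measr0; last first.
      by rewrite -subset0 => x [Ix [[_ nIx] _]].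
    by move=> *; lra.
  by exists I'; split=> //; apply: le_trans gain; rewrite lerD2l.
pose D2 := D `\` S l; have mD2 : measurable D2 := measurableD mD (mS l).
have eD2 : e / 2 <= m D2 by have := measrID mu mD (mS l); rewrite -/D2; move=> *; lra.
have D2I : D2 `<=` \bigcup_j I j.
  move=> x [[Bx nIx] nSx]; have [//|Sx] := BX _ Bx.
  by have [|//] := sub l (ltnSn l) _ Sx.
have [|j jD2] := pigeonhole mI mD2 D2I; first by lra.
pose D0 := D2 `&` I j; have mD0 : measurable D0 := measurableI _ _ mD2 (mI j).
have {jD2} lamD0 : 2 * c * e <= lam * m D0.
  rewrite -/D0 in jD2; rewrite -clam; nra.
have D0S x n : (n <= l)%N -> S n x -> ~ D0 x.
  by move=> nl /(incS _ _ nl) Sx [[_]].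
(* [D0] is not null and avoids [I i]. *)
have ij : j != i.
  apply/eqP => ji; move: lamD0; rewrite (_ : D0 = set0) ?measr0; first by nra.
  by rewrite -subset0 /D0 ji => x [[[_ nIx] _] Ix].
have FD0 : F i (I i `|` D0).
  apply: (indep_subset (MF i) _ _ FB); first exact: measurableU.
  by move=> x [/IB//|[[[Bx _] _] _]].
have pI1 := transfer_packing pI mD0 FD0.
have restrictE p n : (n < l)%N ->
    transfer I i D0 p `&` S n.+1 = I p `&` S n.+1.
  move=> nl; apply/seteqP; split=> x; rewrite /transfer; case: eqP => _.
  - by move=> [[//|D0x] /(D0S _ _ nl)].
  - by move=> [[]].
  - by move=> [? ?]; split=> //; left.
  - by move=> [? Sx]; split=> //; split=> //; exact: D0S Sx.
have [||||||I' [pI' II' I'S gain]] := IH (transfer I i D0) j (c * e) pI1.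
- rewrite bigcup_transfer -subset0 -disj => x [Sx [//|D0x]].
  by case: (D0S x 0%N).
- by move=> n nl; rewrite bigcup_transfer => x /(sub _ (ltnW nl))[|]; [left|right; left].
- by move=> n nl p E mE; rewrite restrictE//; exact: (exch n (ltnW nl)).
- exact: mulr_gt0.
- by rewrite mulrA -exprSr.
- rewrite /transfer (negPf ij).
  have mID := measurableD (mI j) mD0; have mIS := measurableI _ _ (mI j) (mS l.+1).
  have mY := measurableU _ _ mID (mS l); have mX := measurableU _ _ (mS l) mIS.
  have D0sub : D0 `<=` (I j `&` S l.+1) `\` S l.
    move=> x [[[Bx nIx] nSx] Ijx]; split=> //; split=> //.
    by case: (BX _ Bx).
  have := exch l (ltnSn l) j D0 mD0 D0sub.
  have := rank_submodular (MF j) mX mY.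
  (* The exchange property is stated for [I j `&` S l.+1]; submodularity carries
     it to the whole of [I j]. *)
  rewrite (_ : _ `|` _ `|` _ = I j `|` S l); last first.
    apply/seteqP; split=> x; first by set_tac.
    move=> [Ijx|]; last by set_tac.
    by have [/D0sub|] := pselect (D0 x); set_tac.
  have : r j (S l `|` ((I j `&` S l.+1) `\` D0)) <=
      r j ((S l `|` (I j `&` S l.+1)) `&` ((I j `\` D0) `|` S l)).
    apply: le_rank => //; [|exact: measurableI|set_tac].
    by apply: measurableU => //; exact: measurableD.
  have := indep_le_rank (MF j) (measurableU _ _ (mI j) (mS l)) (pI.1 j) (@subsetUl _ _ _).
  have D0I : D0 `<=` I j by exact: subIsetr.
  have := measrDsub mu mD0 (mI j) D0I.
  have : c ^+ l.+1 * e <= c * e.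
    by rewrite ler_pM2r// exprS ger_pMr// exprn_ile1// ?ltW//; lra.
  by move=> *; lra.
exists I'; split => //.
- by move=> x Ux; apply: II'; rewrite bigcup_transfer; left.
- move=> x /I'S; rewrite bigcup_transfer => -[|[|D0x]]; [by left|by right|].
  by right; exact: D2I D0x.1.
- apply: le_trans gain; rewrite mulrA -exprSr lerD2r bigcup_transfer.
  have mU := packing_bigcup_measurable pI.
  by apply: le_measr => //; exact: measurableU.
Qed.

End Packing.

(** * Approximate duality between packings and rank sums *)

Section NearOptimal.
Context (R : realType) (d : measure_display) (T : measurableType d).
Variables (mu : {finite_measure set T -> \bar R}) (k : nat).
Variable F : 'I_k -> set (set T).
Hypothesis MF : forall i, measurable_matroid mu (F i).
Local Notation m := (measr mu).
Local Notation r i := (rankr mu (F i)).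
Implicit Types (X Y Z A : set T) (I : 'I_k -> set T).

(** For each [j], let [G] nearly minimise [r j (G `|` X) - (1 - lam) * m G] over
    the subsets of [I j]. Comparing [G] with [G `\` D] gives the exchange
    property; comparing it with [I j] shows that [G] spans [X] up to [lam], [eta]
    and the part of [X] that could be added to [I j]. The next layer adds these
    sets [G] to [X]. *)
Lemma exists_next_layer I X (lam eta : R) : packing F I -> measurable X ->
    0 < lam -> lam <= 1 -> 0 < eta ->
  exists2 Y, measurable Y & [/\ X `<=` Y, Y `<=` X `|` \bigcup_i I i,
    exchangeable mu F lam eta I X Y &
    forall j, r j X + m (I j) <=
      r j (I j `|` X) + lam * m (I j) + eta + m (I j `&` Y)].
Proof.
move=> pI mX lam0 lam1 eta0; have mI j := packing_measurable MF j pI.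
have /choice[G GP] : forall j, exists G, [/\ measurable G, G `<=` I j &
    forall H, measurable H -> H `<=` I j ->
      (1 - lam) * m H - r j (H `|` X) <= (1 - lam) * m G - r j (G `|` X) + eta].
  move=> j; have [|||G [mG GI] topG] := @near_max R _
      [set H | measurable H /\ H `<=` I j]
      (fun H => (1 - lam) * m H - r j (H `|` X)) (m setT) eta.
  - by exists set0; split=> //; exact: sub0set.
  - move=> H [mH HI]; have := rank_ge0 (MF j) (measurableU _ _ mH mX).
    have := le_measr mu mH measurableT (@subsetT _ H).
    by have := measr_ge0 mu H; move=> *; nra.
  - by [].
  by exists G; split=> // H mH HI; exact: topG.
have mG j : measurable (G j) by case: (GP j).
have GI j : G j `<=` I j by case: (GP j).
have IYE j x : ~ X x -> (I j `&` (X `|` \bigcup_i G i)) x <-> G j x.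
  move=> nXx; split=> [[Ijx [//|[i _ Gix]]]|Gjx].
    by rewrite (packing_disjoint pI Ijx (GI _ _ Gix)).
  by split; [exact: GI|right; exists j].
exists (X `|` \bigcup_i G i).
  by apply: measurableU => //; exact: fin_bigcup_measurable.
split.
- exact: subsetUl.
- by move=> x [Xx|[i _ /GI Iix]]; [left|right; exists i].
- move=> j D mD DG.
  have DG' : D `<=` G j by move=> x /DG[IY nX]; apply/IYE.
  rewrite (_ : X `|` _ = G j `|` X); last first.
    apply/seteqP; split=> x; have := IYE j x; have := pselect (X x);
      rewrite /setU /setI /=; tauto.
  rewrite (_ : X `|` _ = (G j `\` D) `|` X); last first.
    apply/seteqP; split=> x; have := IYE j x; have := pselect (X x);
      rewrite /setU /setI /setD /=; tauto.
  have [_ _ /(_ (G j `\` D))] := GP j.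
  move=> /(_ (measurableD (mG j) mD) (subset_trans (@subDsetl _ _ _) (GI j))).
  by rewrite (measrDsub mu mD (mG j) DG'); move=> *; lra.
- move=> j; have [_ _ /(_ (I j) (mI j) (@subset_refl _ _))] := GP j.
  have : m (G j) <= m (I j `&` (X `|` \bigcup_i G i)).
    apply: le_measr => //.
      apply: measurableI => //; apply: measurableU => //.
      exact: fin_bigcup_measurable.
    by move=> x Gx; split; [exact: GI|right; exists j].
  have : r j X <= r j (G j `|` X).
    by apply: le_rank => //; exact: measurableU.
  by have := measr_ge0 mu (G j); move=> *; nra.
Qed.

Lemma packing_le_dual I A X : packing F I -> measurable A -> measurable X ->
  \bigcup_i I i `<=` A -> m (\bigcup_i I i) <= m (A `\` X) + \sum_i r i X.
Proof.
move=> pI mA mX IA; have mI j := packing_measurable MF j pI.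
have mU := packing_bigcup_measurable MF pI.
have mIX j : measurable (I j `&` X) by exact: measurableI.
rewrite (measrID mu mU mX) addrC lerD//.
  by apply: le_measr; [exact: measurableD|exact: measurableD|exact: setSD].
rewrite setIC setI_bigcupr; apply: le_trans (measr_bigcup_le mu _) _ => [i|].
  by rewrite setIC.
apply: ler_sum => i _; rewrite setIC.
apply: (indep_le_rank (MF i)) => //.
by apply: (indep_subset (MF i) _ _ (pI.1 i)) => //; exact: subIsetl.
Qed.

(** Take a packing above [I] whose measure is within [eta / 2] of the supremum,
    and build layers starting from the part of [A] it misses. By [augment] no
    layer of index below [N] contains a set of measure [e1] addable to some
    [I' j], since that would gain [eta]. Some layer [S l] with [l < N] grows by
    at most [m A / N]; it is nearly spanned, in each matroid, by the trace of
    [I' j] on it, and it contains everything that the packing misses. So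
    [X := S l] nearly matches the measure of the packing. *)
Lemma near_optimal_packing I A (e : R) : packing F I -> measurable A ->
    \bigcup_i I i `<=` A -> 0 < e ->
  exists I' X, [/\ packing F I', \bigcup_i I i `<=` \bigcup_i I' i,
    \bigcup_i I' i `<=` A, measurable X /\ X `<=` A &
    m (A `\` X) + \sum_i r i X <= m (\bigcup_i I' i) + e].
Proof.
move=> pI mA IA e0.
pose K : R := k.+1%:R; have K0 : 0 < K by rewrite ltr0n.
have kK : k%:R <= K by rewrite ler_nat.
have M0 := measr_ge0 mu A.
(* The error is at most [k * (2 * e1 + lam * m A) + m A / N]; the constants make
   its terms at most [e / 4], [e / 8] and [e / 4]. *)
pose lam := e / (8 * K * (m A + e)).
have den0 : 0 < 8 * K * (m A + e) by rewrite !mulr_gt0//; lra.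
have lam0 : 0 < lam by rewrite divr_gt0.
have lamE : lam * K * (m A + e) = e / 8.
  by rewrite /lam; field; rewrite !lt0r_neq0//; lra.
have K1 : 1 <= K by rewrite ler1n.
have lam1 : lam <= 1.
  by rewrite ler_pdivrMr// mul1r; have := mulr_ge0 (ltW K0) M0; nra.
pose c := lam / (4 * K).
have c0 : 0 < c by rewrite divr_gt0// mulr_gt0.
have clam : c * (4 * K) = lam by rewrite /c mulfVK// lt0r_neq0// mulr_gt0.
have c1 : c <= 1 by nra.
pose e1 := e / (8 * K).
have e10 : 0 < e1 by rewrite divr_gt0// mulr_gt0.
have e1E : e1 * K = e / 8 by rewrite /e1; field; rewrite lt0r_neq0.
have [N N0 MN] : exists2 N, (0 < N)%N & m A / N%:R <= e / 4.
  have /ltr_add_invr[n] : 0 < e / (4 * (m A + 1)).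
    by rewrite divr_gt0// mulr_gt0//; lra.
  rewrite add0r => /ltW ltn; exists n.+1 => //.
  apply: (@le_trans _ _ ((m A + 1) * (e / (4 * (m A + 1))))).
    by apply: ler_pM => //; lra.
  rewrite le_eqVlt; apply/orP; left; apply/eqP; field.
  by rewrite lt0r_neq0//; lra.
pose eta := c ^+ N * e1.
have eta0 : 0 < eta by rewrite mulr_gt0// exprn_gt0.
have cle n : (n <= N)%N -> eta <= c ^+ n * e1.
  by move=> nN; rewrite ler_pM2r// ler_wiXn2l// ltW.
have eta_e1 : eta <= e1 by have := cle 0%N (leq0n _); rewrite expr0 mul1r.
have [|||I' [pI' II' I'A] top] := @near_max R _
    [set I' | [/\ packing F I', \bigcup_i I i `<=` \bigcup_i I' i &
      \bigcup_i I' i `<=` A]] (fun I' => m (\bigcup_i I' i)) (m A) (eta / 2).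
- by exists I; split.
- move=> I' [pI' _ I'A]; apply: le_measr => //.
  exact: (packing_bigcup_measurable MF pI').
- by rewrite divr_gt0.
have mI j := packing_measurable MF j pI'.
have mU := packing_bigcup_measurable MF pI'.
pose layer (n : nat) X Y := [/\ X `<=` Y, Y `<=` X `|` \bigcup_i I' i,
    exchangeable mu F lam eta I' X Y &
    forall j, r j X + m (I' j) <=
      r j (I' j `|` X) + lam * m (I' j) + eta + m (I' j `&` Y)].
have [|S [S0 mS SP]] := @dependent_iteration _ (measurable : set T -> Prop) layer
    (A `\` \bigcup_i I' i) (measurableD mA mU).
  by move=> n X mX; exact: exists_next_layer.
have incS : {homo S : a b / (a <= b)%N >-> a `<=` b}.
  move=> a b /subnK <-; elim: (b - a)%N => [//|n IH].
  by apply: subset_trans IH _; case: (SP (n + a)%N).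
have SA n : S n `<=` A.
  elim: n => [|n IH]; first by rewrite S0; exact: subDsetl.
  by have [_ SU _ _] := SP n => x /SU[/IH|/I'A].
have disj : S 0%N `&` \bigcup_i I' i = set0 by rewrite S0; exact: setDKI.
have [|||l lN slow] := @exists_small_step R (fun n => m (S n)) (m A) N.
- by [].
- exact: measr_ge0.
- by move=> n; apply: le_measr.
have unaug j : r j (I' j `|` S l) <= m (I' j) + e1.
  rewrite leNgt; apply/negP => /ltW aug.
  have [|||I2 [pI2 I'2 I2A gain]] := augment (eta := eta) MF c0 clam lam1 mS
      incS pI' disj _ _ e10 _ aug.
  - by move=> n _; case: (SP n).
  - by move=> n _; case: (SP n).
  - exact/cle/ltnW.
  have : m (\bigcup_j I2 j) <= m (\bigcup_j I' j) + eta / 2.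
    apply: top; split => //; first exact: subset_trans I'2.
    by move=> x /I2A[/SA|/I'A].
  by have := cle l (ltnW lN); move=> *; lra.
exists I', (S l); split=> //.
have mIS j : measurable (I' j `&` S l.+1) by exact: measurableI.
have rS : \sum_j r j (S l) <= k%:R * (2 * e1 + lam * m A) + m (\bigcup_i I' i `&` S l.+1).
  rewrite setIC setI_bigcupr measr_bigcup; last first.
  - by apply: trivIset_setIl; case: pI'.
  - by move=> i; rewrite setIC.
  rewrite mulr_natl -[X in _ *+ X](card_ord k) -sumr_const -big_split/=.
  apply: ler_sum => j _; rewrite setIC.
  have [_ _ _ /(_ j)] := SP l; have := unaug j.
  have : lam * m (I' j) <= lam * m A.
    rewrite ler_pM2l//; apply: le_measr => //.
    by apply: subset_trans I'A => x Ix; exists j.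
  by move=> *; lra.
have AS : m (A `\` S l) <= m (\bigcup_i I' i `\` S l).
  apply: le_measr; [exact: measurableD|exact: measurableD|move=> x [Ax nSx]].
  split=> //; apply: contrapT => nUx; apply: nSx; apply: (incS 0%N) => //.
  by rewrite S0.
have US : m (\bigcup_i I' i `&` S l.+1) <=
    m (\bigcup_i I' i `&` S l) + (m (S l.+1) - m (S l)).
  have SS : S l `<=` S l.+1 by exact: incS.
  rewrite -(measrDsub mu (mS l) (mS l.+1) SS).
  have mUS := measurableI _ _ mU (mS l).
  have mDS := measurableD (mS l.+1) (mS l).
  apply: le_trans (measrU_le mu mUS mDS); apply: le_measr.
  - exact: measurableI.
  - exact: measurableU.
  - by move=> x [Ux Sx]; have [|] := pselect (S l x); [left|right].
have := measrID mu mU (mS l).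
have klam : k%:R * (2 * e1 + lam * m A) <= 3 * e / 8.
  have : k%:R * (2 * e1 + lam * m A) <= K * (2 * e1 + lam * m A).
    apply: ler_wpM2r => //; have := mulr_ge0 (ltW lam0) M0.
    by move=> *; lra.
  have := mulr_ge0 (mulr_ge0 (ltW lam0) (ltW K0)) (ltW e0).
  by move=> *; lra.
by move=> *; lra.
Qed.

(** The independence augmentation axiom for unions of packings, up to [e]: inside
    the union of both, the packing [I] grows to one nearly as large as [J], since
    [J] bounds the dual value from below. *)
Lemma packing_exchange I J (e : R) : packing F I -> packing F J -> 0 < e ->
  exists I', [/\ packing F I', \bigcup_i I i `<=` \bigcup_i I' i,
    \bigcup_i I' i `<=` \bigcup_i I i `|` \bigcup_i J i &
    m (\bigcup_i J i) <= m (\bigcup_i I' i) + e].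
Proof.
move=> pI pJ e0; have mU := measurableU _ _ (packing_bigcup_measurable MF pI)
  (packing_bigcup_measurable MF pJ).
have [I' [X [pI' II' I'A [mX _] opt]]] :=
  near_optimal_packing pI mU (@subsetUl _ _ _) e0.
exists I'; split=> //; apply: le_trans opt.
by apply: packing_le_dual => //; exact: subsetUr.
Qed.

End NearOptimal.

(** * Attainment of minima of submodular functions *)

Section Argmin.
Context (R : realType) (d : measure_display) (T : measurableType d).
Variable mu : {finite_measure set T -> \bar R}.
Local Notation m := (measr mu).
Implicit Types (X Y Z A : set T) (E : nat -> set T).

Definition liminf_set E : set T := \bigcup_n \bigcap_(p >= n) E p.

Lemma measurable_tail_bigcap E n : (forall p, measurable (E p)) ->
  measurable (\bigcap_(p >= n) E p).
Proof. by move=> mE; apply: bigcap_measurable => //; exists n => /=. Qed.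

Lemma measurable_liminf_set E : (forall p, measurable (E p)) ->
  measurable (liminf_set E).
Proof. by move=> mE; apply: bigcup_measurable => n _; exact: measurable_tail_bigcap. Qed.

Lemma tail_bigcap_incr E n : \bigcap_(p >= n) E p `<=` \bigcap_(p >= n.+1) E p.
Proof. by move=> x Ex p np; apply: Ex; exact: ltnW. Qed.

Lemma measr_incr_cvg E (e : R) : (forall n, measurable (E n)) ->
    (forall n, E n `<=` E n.+1) -> 0 < e ->
  exists n, m (\bigcup_p E p `\` E n) <= e.
Proof.
move=> mE incE e0; have mU : measurable (\bigcup_p E p) by exact: bigcup_measurable.
apply: measr_decr_cvg0 => // [n|n|]; first exact: measurableD.
  by apply: setDS; exact: incE.
by rewrite -subset0 => x Ex; have [[p _ Epx] _] := Ex 0%N I; have [] := Ex p I.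
Qed.

(** The lower limit of a sequence of near-minimisers is a minimiser when their
    errors are summable: by submodularity the excess of an intersection is at most
    the sum of the excesses, and the Lipschitz bound passes to monotone limits. *)
Lemma exists_submodular_argmin (h : set T -> R) (C : R) A : 0 <= C ->
    (forall X, measurable X -> 0 <= h X) ->
    (forall X Y, measurable X -> measurable Y ->
      h (X `|` Y) + h (X `&` Y) <= h X + h Y) ->
    (forall X Y, measurable X -> measurable Y ->
      h X <= h Y + C * (m (X `\` Y) + m (Y `\` X))) ->
  exists2 X, measurable X /\ X `<=` A &
    forall Y, measurable Y -> Y `<=` A -> h X <= h Y.
Proof.
move=> C0 h0 subm lip.
have small e : 0 < e -> exists2 e', 0 < e' & C * e' <= e.
  move=> e0; exists (e / (C + 1)); first by rewrite divr_gt0// ltr_wpDl.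
  by rewrite mulrCA ger_pMr// ler_pdivrMr ?ltr_wpDl// mul1r lerDl.
pose eps (n : nat) : R := 2^-1 ^+ n.
have eps0 n : 0 < eps n by rewrite exprn_gt0// invr_gt0.
have epsS n : eps n = 2 * eps n.+1 by rewrite /eps exprS mulrA mulfV ?mul1r.
have /choice[X XP] : forall n, exists X, [/\ measurable X, X `<=` A &
    forall Y, measurable Y -> Y `<=` A -> h X <= h Y + eps n.+1].
  move=> n; have [|||X [mX XA] minX] := @near_max R _
    [set X | measurable X /\ X `<=` A] (fun X => - h X) 0 (eps n.+1).
  - by exists set0; split=> //; exact: sub0set.
  - by move=> X [mX _]; rewrite oppr_le0 h0.
  - exact: eps0.
  by exists X; split=> // Y mY YA; have := minX Y (conj mY YA); lra.
have mX n : measurable (X n) by case: (XP n).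
have XA n : X n `<=` A by case: (XP n).
pose W n := fix W p := if p is q.+1 then W q `&` X (n + q.+1)%N else X n.
have mW n p : measurable (W n p).
  by elim: p => [|p IH] /=; [exact: mX|exact: measurableI].
have WA n p : W n p `<=` A.
  by elim: p => [|p IH] /=; [exact: XA|move=> x [/IH]].
(* The right-hand error is the sum of [eps q.+1] over [n <= q <= n + p]. *)
have hW n p Y : measurable Y -> Y `<=` A -> h (W n p) <= h Y + eps n - eps (n + p).+1.
  move=> mY YA; elim: p => [|p IH].
    rewrite addn0; have [_ _ /(_ Y mY YA)] := XP n.
    by rewrite [eps n]epsS; lra.
  have [_ _ minX] := XP (n + p.+1)%N.
  have := minX _ (measurableU _ _ (mW n p) (mX (n + p.+1)%N)).
  have UA : W n p `|` X (n + p.+1)%N `<=` A by move=> x [/WA|/XA].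
  move=> /(_ UA); have := subm _ _ (mW n p) (mX (n + p.+1)%N).
  have := epsS (n + p).+1; rewrite /= addnS; lra.
have tailW n : \bigcap_p W n p = \bigcap_(p >= n) X p.
  apply/seteqP; split=> x Wx p => [/= np|_].
    have := Wx (p - n)%N I; case E : (p - n)%N => [|q] /=.
      by have -> : p = n by apply/eqP; rewrite eqn_leq np -subn_eq0 E eqxx.
    by rewrite -E subnKC// => -[].
  elim: p => [|p IH] /=; first by apply: Wx => /=.
  by split=> //; apply: Wx => /=; exact: leq_addr.
have mtail n := measurable_tail_bigcap n mX.
have tailA n : \bigcap_(p >= n) X p `<=` A by move=> x /(_ n (leqnn n)) /XA.
have htail n Y : measurable Y -> Y `<=` A -> h (\bigcap_(p >= n) X p) <= h Y + eps n.
  move=> mY YA; apply/ler_addgt0Pr => e /small[e' e'0 Ce'].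
  have [||||p Wp] := @measr_decr_cvg0 _ _ _ mu
      (fun p => W n p `\` \bigcap_(q >= n) X q) e'.
  - by move=> p; exact: measurableD.
  - by move=> p; apply: setSD => x [].
  - rewrite -tailW -subset0 => x Wx; have [_] := Wx 0%N I.
    by apply=> p _; case: (Wx p I).
  - by [].
  have Wsub : \bigcap_(q >= n) X q `\` W n p = set0.
    by rewrite setD_eq0 -tailW => x /(_ p I).
  have := lip _ _ (mtail n) (mW n p); rewrite Wsub measr0 add0r.
  have := hW n p Y mY YA; have := eps0 (n + p).+1.
  by have := ler_wpM2l C0 Wp; move=> *; lra.
have mL := measurable_liminf_set mX.
exists (liminf_set X); first by split=> // x [n _ /tailA].
move=> Y mY YA; apply/ler_addgt0Pr => e e0.
have e20 : 0 < e / 2 by rewrite divr_gt0.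
have [e' e'0 Ce'] := small _ e20.
have [p Xp] := measr_incr_cvg mtail (@tail_bigcap_incr X) e'0.
have [q eps_q] : exists q, eps q <= e / 2.
  have [q ltq] := ltr_add_invr e20; exists q; rewrite add0r in ltq.
  apply: le_trans (ltW ltq); rewrite /eps exprVn -natrX.
  by rewrite lef_pV2 ?posrE ?ltr0n ?expn_gt0// ler_nat ltn_expl.
pose n := maxn p q.
have eps_n : eps n <= eps q.
  by rewrite ler_wiXn2l ?leq_maxr// ?invr_ge0// invf_le1// ler1n.
have Ln : m (liminf_set X `\` \bigcap_(p >= n) X p) <= e'.
  apply: le_trans Xp; apply: le_measr; [exact: measurableD|exact: measurableD|].
  by apply: setDS => x Xx i ni; apply: Xx; exact: leq_trans (leq_maxl p q) ni.
have nL : \bigcap_(p >= n) X p `\` liminf_set X = set0.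
  by rewrite setD_eq0 => x Xx; exists n.
have := lip _ _ mL (mtail n); rewrite nL measr0 addr0.
by have := htail n Y mY YA; have := ler_wpM2l C0 Ln; move=> *; lra.
Qed.

End Argmin.

(** * The measurable union *)

Section Union.
Context (R : realType) (d : measure_display) (T : measurableType d).
Variables (mu : {finite_measure set T -> \bar R}) (k : nat).
Variable F : 'I_k -> set (set T).
Hypothesis MF : forall i, measurable_matroid mu (F i).
Local Notation m := (measr mu).
Local Notation r i := (rankr mu (F i)).
Local Notation U := (measurable_union mu F).
Implicit Types (X Y Z A : set T) (E : nat -> set T).

Lemma ae_sameE X Y : measurable X -> measurable Y ->
  ae_same mu X Y <-> ae_sub mu X Y /\ ae_sub mu Y X.
Proof.
move=> mX mY; have mXY := measurableD mX mY; have mYX := measurableD mY mX.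
split=> [XY|[XY YX]].
  by split; apply: (subset_measure0 _ _ _ XY) => //; exact: measurableU.
by rewrite /ae_same measureU0.
Qed.

Lemma ae_increasing_cvg E (e : R) : (forall n, measurable (E n)) ->
    ae_increasing mu E -> 0 < e ->
  exists n, m (\bigcup_p E p `\` E n) <= e.
Proof.
move=> mE incE e0; pose E' n := \bigcup_(p in [set p | (p <= n)%N]) E p.
have mE' n : measurable (E' n) by exact: bigcup_measurable.
have [|n En] := measr_incr_cvg mu mE' _ e0.
  by move=> n x [p /= pn Epx]; exists p => //=; exact: ltnW.
exists n; apply: le_trans En.
have -> : \bigcup_p E' p = \bigcup_p E p.
  apply/seteqP; split=> x [p]; first by move=> _ [q _ Eqx]; exists q.
  by move=> _ Epx; exists p => //; exists p => /=.
have mU : measurable (\bigcup_p E p) by exact: bigcup_measurable.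
have E'n : ae_sub mu (E' n) (E n).
  rewrite /E' bigcup_mkcond; apply: ae_sub_bigcup => // p; case: ifPn => //.
  - by rewrite inE => pn; exact: incE.
  - by move=> _; apply: ae_sub_subset; exact: sub0set.
have nul := proj1 (ae_subE mu (mE' n) (mE n)) E'n.
have mD1 := measurableD mU (mE' n); have mD2 := measurableD (mE' n) (mE n).
rewrite -[leRHS]addr0 -nul; apply: le_trans (measrU_le mu mD1 mD2).
apply: le_measr; [exact: measurableD|exact: measurableU|].
by move=> x [Ux nEx]; have [|] := pselect (E' n x); [right|left].
Qed.

Lemma union_ae_same X Y : U X -> measurable Y -> ae_same mu X Y -> U Y.
Proof.
move=> [mX [E [SE incE] XE]] mY XY; split=> //; exists E => //.
have mU : measurable (\bigcup_n E n) by apply: bigcup_measurable => n _; case: (SE n).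
move/(ae_sameE mX mU) : XE => [XE EX]; move/(ae_sameE mX mY) : XY => [XY YX].
apply/ae_sameE => //; split.
- exact: (ae_sub_trans mY mX mU).
- exact: (ae_sub_trans mU mX mY).
Qed.

Lemma union_liminf (I : nat -> 'I_k -> set T) : (forall n, packing F (I n)) ->
  U (liminf_set (fun n => \bigcup_i I n i)).
Proof.
move=> pI; have mI n := packing_bigcup_measurable MF (pI n).
have mt n := measurable_tail_bigcap n mI.
split; first exact: measurable_liminf_set.
exists (fun n => \bigcap_(p >= n) \bigcup_i I p i); last first.
  by rewrite /ae_same setDv setU0 measure0.
split=> [n|]; last first.
  apply: ae_increasing_step => // n; apply: ae_sub_subset.
  exact: tail_bigcap_incr.
split=> //; exists (fun i => I n i `&` \bigcap_(p >= n) \bigcup_i I p i).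
  move=> i; apply: (indep_subset (MF i) _ _ ((pI n).1 i)) => //.
  by apply: measurableI => //; exact: (packing_measurable MF i (pI n)).
rewrite -setI_bigcupl (_ : _ `&` _ = \bigcap_(p >= n) \bigcup_i I p i).
  by rewrite /ae_same setDv setU0 measure0.
by apply: setIidr => x /(_ n (leqnn n)).
Qed.

(** The independent sets that cover [X] are made disjoint by keeping each point in
    the first of them that contains it. *)
Lemma family_sum_packing X Y : family_sum mu F X -> measurable Y ->
  exists I, [/\ packing F I, \bigcup_i I i `<=` Y &
    m (Y `\` \bigcup_i I i) <= m (Y `\` X)].
Proof.
move=> [mX [G FG XG]] mY.
have mG i : measurable (G i) by exact: (indep_measurable (MF i)).
have mUG : measurable (\bigcup_i G i) by exact: fin_bigcup_measurable.
pose I i := (G i `&` Y) `\` \bigcup_(j in [set j : 'I_k | (j < i)%N]) G j.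
have UI : \bigcup_i I i = \bigcup_i G i `&` Y.
  apply/seteqP; split=> [x [i _ [[Gix Yx] _]]|x [[i0 _ Gx] Yx]].
    by split=> //; exists i.
  have := @arg_minnP _ i0 (fun i => `[< G i x >]) (@nat_of_ord k).
  move=> /(_ (asboolT Gx))[i /asboolP Gix min_i].
  exists i => //; split=> // -[j /= ji /asboolP /min_i].
  by rewrite leqNgt ji.
exists I; split.
- split=> [i|i j _ _ [x [[[Gix _] nI] [[Gjx _] nJ]]]].
    apply: (indep_subset (MF i) _ _ (FG i)); last by move=> x [[]].
    apply: measurableD; first exact: measurableI.
    by apply: fin_bigcup_measurable => //; exact: finite_finset.
  case: (ltngtP (i : nat) j) => [lt_ij|lt_ji|eq_ij]; last exact: ord_inj.
  + by case: nJ; exists i.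
  + by case: nI; exists j.
- by rewrite UI; exact: subIsetr.
move/(ae_sameE mX mUG) : XG => [XG _].
have nul := proj1 (ae_subE mu mX mUG) XG.
have mD1 := measurableD mY mX; have mD2 := measurableD mX mUG.
rewrite UI -[leRHS]addr0 -nul; apply: le_trans (measrU_le mu mD1 mD2).
apply: le_measr; [|exact: measurableU|].
  by apply: measurableD => //; exact: measurableI.
move=> x [Yx nGY]; have [Xx|] := pselect (X x); last by left.
by right; split=> // Gx; apply: nGY.
Qed.

(** For the converse: if packings inside [Y] miss parts of measures
    [1 / 2 ^ n.+1], then by Borel-Cantelli their lower limit, an increasing union of packable sets, is
    [Y] up to a null set. *)
Lemma unionP Y : U Y <-> measurable Y /\ forall e, 0 < e ->
  exists I, [/\ packing F I, \bigcup_i I i `<=` Y & m (Y `\` \bigcup_i I i) <= e].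
Proof.
split=> [[mY [E [SE incE] YE]]|[mY approx]].
  split=> // e e0; have mE n : measurable (E n) by case: (SE n).
  have mUE : measurable (\bigcup_n E n) by exact: bigcup_measurable.
  have [n En] := ae_increasing_cvg mE incE e0.
  have [I [pI IY Ile]] := family_sum_packing (SE n) mY.
  exists I; split=> //; apply: le_trans Ile _; apply: le_trans En.
  move/(ae_sameE mY mUE) : YE => [YE _].
  have nul := proj1 (ae_subE mu mY mUE) YE.
  have mD1 := measurableD mUE (mE n); have mD2 := measurableD mY mUE.
  rewrite -[leRHS]addr0 -nul; apply: le_trans (measrU_le mu mD1 mD2).
  apply: le_measr; [exact: measurableD|exact: measurableU|].
  move=> x [Yx nE]; have [Ux|nUx] := pselect ((\bigcup_n E n) x); [left|right]; by [].
have /choice[I IP] : forall n : nat, exists I, [/\ packing F I, \bigcup_i I i `<=` Y &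
    m (Y `\` \bigcup_i I i) <= 1 / (2 ^ n.+1)%:R].
  by move=> n; apply: approx; rewrite divr_gt0// ltr0n expn_gt0.
have pI n : packing F (I n) by case: (IP n).
have UL := union_liminf pI; apply: (union_ae_same UL) => //.
have mI n := packing_bigcup_measurable MF (pI n).
have mL : measurable (liminf_set (fun n => \bigcup_i I n i)).
  exact: measurable_liminf_set.
apply/ae_sameE => //; split.
  apply: ae_sub_subset => x [n _ /(_ n (leqnn n))].
  by have [_ + _] := IP n; apply.
apply/ae_subE => //.
apply: (@lim_sup_null _ _ _ mu (fun n => Y `\` \bigcup_i I n i) _ 1).
- by move=> n; exact: measurableD.
- exact: measurableD.
- move=> x [Yx nLx] n _; apply: contrapT => nE; apply: nLx; exists n => // p np.
  by apply: contrapT => nI; apply: nE; exists p.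
- by move=> n; case: (IP n).
Qed.

Lemma union_bigcup E : (forall n, U (E n)) -> ae_increasing mu E ->
  U (\bigcup_n E n).
Proof.
move=> UE incE; have mE n : measurable (E n) by case: (UE n).
have mUE : measurable (\bigcup_n E n) by exact: bigcup_measurable.
apply/unionP; split=> // e e0; have e20 : 0 < e / 2 by rewrite divr_gt0.
have [n En] := ae_increasing_cvg mE incE e20.
have [_ /(_ _ e20)[I [pI IE Ie]]] := proj1 (unionP (E n)) (UE n).
have mI := packing_bigcup_measurable MF pI.
exists I; split=> //; first by move=> x /IE Enx; exists n.
have mD1 := measurableD mUE (mE n); have mD2 := measurableD (mE n) mI.
have := measrU_le mu mD1 mD2.
have : m (\bigcup_n E n `\` \bigcup_i I i) <=
    m ((\bigcup_n E n `\` E n) `|` (E n `\` \bigcup_i I i)).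
  apply: le_measr; [exact: measurableD|exact: measurableU|].
  by move=> x [Ux nIx]; have [|] := pselect (E n x); [right|left].
by move=> *; lra.
Qed.

(** Exact form of [packing_exchange] for members of the union. Packings [I n]
    fill [Y] up to [del n]; by exchange with a packing [V n] already obtained,
    [I n.+1] is extended to a packing [V n.+1] that loses at most [2 * del n] of
    [V n]. As these losses are summable, the lower limit of the [V n] contains [Y]
    and keeps nearly all of [J]. *)
Lemma union_extend Y (J : 'I_k -> set T) (e : R) : U Y -> packing F J -> 0 < e ->
  exists Z, [/\ U Z, ae_sub mu Y Z, Z `<=` Y `|` \bigcup_i J i &
    m (\bigcup_i J i) <= m Z + e].
Proof.
move=> UY pJ e0; have [mY approx] := proj1 (unionP Y) UY.
have e40 : 0 < e / 4 by rewrite divr_gt0.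
pose del n : R := e / 4 / (2 ^ n.+1)%:R.
have del0 n : 0 < del n by rewrite divr_gt0// ltr0n expn_gt0.
have /choice[I IP] : forall n : nat, exists I, [/\ packing F I, \bigcup_i I i `<=` Y &
    m (Y `\` \bigcup_i I i) <= del n] by move=> n; exact: approx.
have pI n : packing F (I n) by case: (IP n).
have IY n : \bigcup_i I n i `<=` Y by case: (IP n).
have mI n := packing_bigcup_measurable MF (pI n).
have e20 : 0 < e / 2 by rewrite divr_gt0.
have [V0 [pV0 IV0 V0sub V0J]] := packing_exchange MF (pI 0%N) pJ e20.
pose step n (V V' : 'I_k -> set T) := [/\ \bigcup_i I n.+1 i `<=` \bigcup_i V' i,
  \bigcup_i V' i `<=` Y `|` \bigcup_i V i &
  m (\bigcup_i V i) <= m (\bigcup_i V' i) + del n].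
have [||V [V0E PV VS]] := @dependent_iteration _
    (fun V => packing F V /\ \bigcup_i V i `<=` Y `|` \bigcup_i J i) step V0.
- by split=> // x /V0sub[/IY|]; [left|right].
- move=> n V [pV VY].
  have [V' [pV' IV' V'sub gain]] := packing_exchange MF (pI n.+1) pV (del0 n).
  exists V'; split=> //; first by move=> x /V'sub[/IY|/VY//]; left.
  by move=> x /V'sub[/IY|]; [left|right].
have pV n : packing F (V n) by case: (PV n).
have mV n := packing_bigcup_measurable MF (pV n).
have IV n : \bigcup_i I n i `<=` \bigcup_i V n i.
  by case: n => [|n]; [rewrite V0E|case: (VS n)].
pose Z := liminf_set (fun n => \bigcup_i V n i).
have mZ : measurable Z by exact: measurable_liminf_set.
exists Z; split.
- exact: union_liminf.
- apply/ae_subE => //.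
  apply: (@lim_sup_null _ _ _ mu (fun n => Y `\` \bigcup_i V n i) _ (e / 4)).
  + by move=> n; exact: measurableD.
  + exact: measurableD.
  + move=> x [Yx nZx] n _; apply: contrapT => nE; apply: nZx; exists n => // p np.
    by apply: contrapT => nV; apply: nE; exists p.
  + move=> n; have [_ _] := IP n; apply: le_trans; apply: le_measr.
    * exact: measurableD.
    * exact: measurableD.
    * exact: setDS.
- by move=> x [n _ /(_ n (leqnn n))]; have [_] := PV n; apply.
have drop : m (\bigcup_i V 0%N i `\` Z) <= e / 2.
  apply: (@measr_bigcup_summable _ _ _ mu
      (fun n => \bigcup_i V n i `\` \bigcup_i V n.+1 i)).
  - by move=> n; exact: measurableD.
  - exact: measurableD.
  - move=> x [V0x nZx]; apply: contrapT => nex; apply: nZx.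
    exists 0%N => // p _; elim: p => // p Vpx; apply: contrapT => nVx.
    by apply: nex; exists p.
  - move=> n; have [_ VYV gain] := VS n; have [_ _ In] := IP n.
    have new : m (\bigcup_i V n.+1 i `\` \bigcup_i V n i) <= del n.
      apply: le_trans In; apply: le_measr; [exact: measurableD|exact: measurableD|].
      by move=> x [/VYV[Yx|//] nVx]; split=> // /IV.
    have -> : e / 2 / (2 ^ n.+1)%:R = 2 * del n.
      by rewrite /del; field; rewrite pnatr_eq0 expn_eq0.
    have := measrID mu (mV n) (mV n.+1).
    have := measrID mu (mV n.+1) (mV n); rewrite setIC.
    by move: gain new; move: (del n) => *; lra.
have := measrID mu (mV 0%N) mZ; rewrite V0E in drop *.
have : m (\bigcup_i V0 i `&` Z) <= m Z.
  by apply: le_measr => //; apply: measurableI => //; rewrite -V0E.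
by move=> *; lra.
Qed.

End Union.

(** * The dual function and the rank formula *)

Section Dual.
Context (R : realType) (d : measure_display) (T : measurableType d).
Variables (mu : {finite_measure set T -> \bar R}) (k : nat).
Variable F : 'I_k -> set (set T).
Hypothesis MF : forall i, measurable_matroid mu (F i).
Local Notation m := (measr mu).
Implicit Types (X Y A : set T).

Lemma dual_submodular A X Y : measurable A -> measurable X -> measurable Y ->
  m (A `\` (X `|` Y)) + \sum_i rankr mu (F i) (X `|` Y) +
    (m (A `\` (X `&` Y)) + \sum_i rankr mu (F i) (X `&` Y)) <=
  m (A `\` X) + \sum_i rankr mu (F i) X + (m (A `\` Y) + \sum_i rankr mu (F i) Y).
Proof.
move=> mA mX mY; rewrite addrACA [leRHS]addrACA; apply: lerD.
  rewrite setDUr setDIr addrC.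
  by rewrite measrUI//; exact: measurableD.
by rewrite -!big_split; apply: ler_sum => i _; exact: rank_submodular.
Qed.

Lemma dual_lipschitz A X Y : measurable A -> measurable X -> measurable Y ->
  m (A `\` X) + \sum_i rankr mu (F i) X <=
  m (A `\` Y) + \sum_i rankr mu (F i) Y +
    (1 + k%:R) * (m (X `\` Y) + m (Y `\` X)).
Proof.
move=> mA mX mY; have mXY := measurableD mX mY; have mYX := measurableD mY mX.
have dA : m (A `\` X) <= m (A `\` Y) + m (Y `\` X).
  have mAY := measurableD mA mY; apply: le_trans (measrU_le mu mAY mYX).
  apply: le_measr; [exact: measurableD|exact: measurableU|].
  by move=> x; have := pselect (Y x); set_tac.
have rX : \sum_i rankr mu (F i) X <= \sum_i rankr mu (F i) Y + k%:R * m (X `\` Y).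
  rewrite mulr_natl -[X in _ *+ X](card_ord k) -sumr_const -big_split/=.
  apply: ler_sum => i _; apply: le_trans (rankU_le (MF i) mY mXY).
  apply: le_rank => //; first exact: measurableU.
  by move=> x; have := pselect (Y x); set_tac.
have := measr_ge0 mu (X `\` Y).
have : 0 <= k%:R * m (Y `\` X) by rewrite mulr_ge0 ?measr_ge0.
by move=> *; lra.
Qed.

End Dual.

Local Open Scope ereal_scope.

Theorem theorem6p21 (R : realType) (d : measure_display) (J : measurableType d)
    (mu : {finite_measure set J -> \bar R})
    (hJ : standard_borel R J) (hmu : atomless mu)
    (k : nat) (F : 'I_k -> set (set J))
    (hF : forall i, measurable_matroid mu (F i)) (A : set J)
    (hA : measurable A) :
  is_minimum (rank mu (measurable_union mu F) A)
    [set mu (A `\` X) + \sum_(i < k) rank mu (F i) X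
      | X in [set X | measurable X /\ ae_sub mu X A]].
Proof.
pose h (X : set J) : R := (measr mu (A `\` X) + \sum_i rankr mu (F i) X)%R.
have hE X : measurable X ->
    mu (A `\` X) + \sum_(i < k) rank mu (F i) X = (h X)%:E.
  move=> mX; rewrite EFinD -sumEFin measrE; last exact: measurableD.
  by congr (_ + _); apply: eq_bigr => i _; exact: rankrE.
have [||||X [mX XA] minX] := @exists_submodular_argmin _ _ _ mu h (1 + k%:R)%R A.
- by rewrite addr_ge0.
- by move=> X mX; rewrite addr_ge0 ?measr_ge0// sumr_ge0// => i _; exact: rank_ge0.
- by move=> X Y mX mY; exact: dual_submodular.
- by move=> X Y mX mY; exact: dual_lipschitz.
(* Counting: a packing in [A] has at most [r_i(Z)] of its i-th member in [Z]. *)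
have weak Y Z : measurable_union mu F Y -> Y `<=` A -> measurable Z ->
    (measr mu Y <= h Z)%R.
  move=> /(unionP hF)[mY approx] YA mZ; apply/ler_addgt0Pr => e e0.
  have [I [pI IY Ie]] := approx e e0.
  have := packing_le_dual hF pI hA mZ (subset_trans IY YA).
  have := measrDsub mu (packing_bigcup_measurable hF pI) mY IY.
  by rewrite -/(h Z) => *; lra.
have mrU : Defs.restrict mu (measurable_union mu F) A `<=` measurable.
  by move=> Y [[]].
have [||Y0 maxY0 _] := @exists_maximal _ _ _ mu _ set0 mrU.
- move=> E AE incE; split.
    by apply: union_bigcup => // n; case: (AE n).
  by apply: ae_sub_bigcup => // n; [exact/mrU|case: (AE n)].
- split; last by apply: ae_sub_subset; exact: sub0set.
  apply/(unionP hF); split=> // e e0; exists (fun=> set0); split.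
  + split=> [i|i j _ _ [x []//]]; exact: indep0 (hF i).
  + by move=> x [].
  + by rewrite set0D measr0 ltW.
rewrite /rank; case: xgetP => [Y _ maxY|/(_ Y0)//].
have [[UY YA] topY] := maxY; have mY : measurable Y by case: UY.
have mYA := measurableI _ _ mY hA.
have UYA : measurable_union mu F (Y `&` A).
  apply: (union_ae_same UY) => //; apply/ae_sameE => //; split.
    by rewrite /ae_sub setDIr setDv set0U.
  by apply: ae_sub_subset; exact: subIsetl.
have YYA : measr mu Y = measr mu (Y `&` A).
  by rewrite (measrID mu mY hA) (proj1 (ae_subE mu mY hA) YA) addr0.
(* If [Y] fell short of the minimum, a near-optimal packing of [A] would extend it
   to a strictly larger member of the union inside [A]. *)
have strong : (h X <= measr mu (Y `&` A))%R.
  apply/ler_addgt0Pr => e e0; have e20 : (0 < e / 2)%R by rewrite divr_gt0.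
  have p0 : packing F (fun=> set0).
    by split=> [i|i j _ _ [x []//]]; exact: indep0 (hF i).
  have [|I [X' [pI _ IA [mX' X'A] opt]]] := near_optimal_packing hF p0 hA _ e20.
    by move=> x [].
  have [Z [UZ YZ ZYI gain]] := union_extend hF UYA pI e20.
  have mZ : measurable Z by case: UZ.
  have ZY : ae_sub mu Z Y.
    apply: topY; first split=> //.
      by apply: ae_sub_subset => x /ZYI[[]|/IA].
    apply: (ae_sub_trans _ _ _ _ YZ) => //.
    by rewrite /ae_sub setDIr setDv set0U.
  have := minX X' mX' X'A; have := ae_sub_measr mZ mY ZY.
  by move: opt; rewrite -/(h X') YYA => *; lra.
have rankE : mu Y = (h X)%:E.
  rewrite measrE// YYA; congr EFin; apply/eqP; rewrite eq_le strong andbT.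
  by apply: weak => //; exact: subIsetr.
split.
  by exists X; [split=> //; exact: ae_sub_subset|rewrite hE].
move=> _ [Z [mZ _] <-]; rewrite hE// measrE// YYA lee_fin.
by apply: weak => //; exact: subIsetr.
Qed.
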